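(* Let $X$ be a real-valued random variable with finite moments of all orders, let $H=\mathbb{R}[x]$ with coproduct $\Delta x^n=\sum_{k=0}^n\binom{n}{k}x^{n-k}\otimes x^k$, and let $\mu\in H^*$ be the linear functional with $\mu(x^n)=\mathbb{E}(X^n)$ for all $n\ge 0$. Let $\mu^{-1}$ be the inverse of $\mu$ for the convolution product $\star$ on $H^*$. Define the linear operator $W:=\mu^{-1}\star\mathrm{id}:H\to H$, i.e. $$W(x^n)=(\mu^{-1}\otimes\mathrm{id})\Delta x^n=\sum_{k=0}^n\binom{n}{k}\mu^{-1}(x^{n-k})\,x^k ,\qquad n\ge 0.$$ Then: 1. $W$ is the only linear operator $H\to H$ such that $$W(1)=1,\qquad \frac{\mathrm d}{\mathrm dx}\circ W=W\circ\frac{\mathrm d}{\mathrm dx},\qquad \mu(W(x^n))=0\ \text{ for all } n\ge 1.$$ 2. $W$ is the only linear operator $H\to H$ such that for all $n\ge 0$ $$x^n=(\mu\otimes W)\Delta x^n=\sum_{k=0}^n\binom{n}{k}\mu(x^{n-k})\,W(x^k).$$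
   Context: $H=\mathbb{R}[x]$ is the polynomial algebra in one variable. For $\alpha,\beta\in H^*$ (the linear dual), the convolution product $\alpha\star\beta\in H^*$ is $(\alpha\star\beta)(x^n):=(\alpha\otimes\beta)\Delta x^n$. This product is commutative and associative, with unit the functional $\varepsilon(x^n)=\mathbf 1_{(n=0)}$, and $\mathcal G(H):=\{\lambda\in H^*:\lambda(1)=1\}$ is a group for $\star$; in particular $\mu\in\mathcal G(H)$ has an inverse $\mu^{-1}\in\mathcal G(H)$. Tensor expressions such as $(\alpha\otimes f)\Delta$, with $\alpha\in H^*$ and $f:H\to H$ linear, are read via $\mathbb{R}\otimes H\cong H$. *)

(* Defs.v *)
From HB Require Import structures.
From mathcomp Require Import all_boot all_order all_algebra.
From mathcomp Require Import all_classical all_reals all_analysis.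

Set Implicit Arguments.
Unset Strict Implicit.
Unset Printing Implicit Defensive.

Import Order.TTheory GRing.Theory Num.Theory.
Local Open Scope ring_scope.

Notation lindual R := {linear {poly R} -> R^o}.

(* The tensor square of R[x] is represented by R[x][y] = {poly {poly R}}: the
   inner variable is the left tensor factor, the outer variable the right one,
   so that x^i (x) x^j is 'X^i *: 'X^j. *)
Definition tens (R : realType) (u v : {poly R}) : {poly {poly R}} :=
  u *: map_poly polyC v.

(* The linear extension of x^n |-> \sum_k 'C(n, k) x^(n-k) (x) x^k. A scalar
   a : R acts on a tensor through a%:P. *)
Definition coprod (R : realType) (p : {poly R}) : {poly {poly R}} :=
  \sum_(n < size p) (p`_n)%:P *:
    \sum_(k < n.+1) tens 'X^(n - k) 'X^k *+ 'C(n, k).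

(* alpha (x) f, followed by the identification of R (x) V with V; V = R^o
   gives tensors of two functionals and V = {poly R} operators. *)
Definition tens_map (R : realType) (V : lmodType R) (alpha : lindual R)
    (f : {linear {poly R} -> V}) (t : {poly {poly R}}) : V :=
  \sum_(k < size t) (alpha t`_k : R) *: f 'X^k.

Definition star (R : realType) (V : lmodType R) (alpha : lindual R)
    (f : {linear {poly R} -> V}) (p : {poly R}) : V :=
  tens_map alpha f (coprod p).

Section Linearity.
Variable R : realType.

Lemma sum_coef_widen (A : nzRingType) (V : zmodType) (g : nat -> A -> V)
    (p : {poly A}) N : (forall i, g i 0 = 0) -> (size p <= N)%N ->
  \sum_(i < size p) g i p`_i = \sum_(i < N) g i p`_i.
Proof.
move=> g0 pN; rewrite -!(big_mkord xpredT (fun i => g i p`_i)).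
rewrite [RHS](big_cat_nat (leq0n _) pN)/= [X in _ = _ + X]big_nat_cond.
rewrite [X in _ = _ + X]big1 ?addr0// => i /andP[/andP[pi _] _].
by rewrite nth_default.
Qed.

Lemma tens_mapD (V : lmodType R) (alpha : lindual R) (f : {linear {poly R} -> V}) :
  {morph tens_map alpha f : s t / s + t}.
Proof.
move=> s t; rewrite /tens_map.
pose N := maxn (size s) (size t).
have g0 i : (alpha 0 : R) *: f 'X^i = 0 by rewrite raddf0 scale0r.
rewrite !(@sum_coef_widen _ _ (fun i (a : {poly R}) => (alpha a : R) *: f 'X^i)
  _ N) ?leq_maxl ?leq_maxr ?size_polyD//.
rewrite -big_split/=; apply: eq_bigr => i _.
by rewrite coefD raddfD -scalerDl.
Qed.

Lemma tens_mapZ (V : lmodType R) (alpha : lindual R) (f : {linear {poly R} -> V})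
    (a : R) (t : {poly {poly R}}) :
  tens_map alpha f (a%:P *: t) = a *: tens_map alpha f t.
Proof.
rewrite /tens_map.
have g0 i : (alpha 0 : R) *: f 'X^i = 0 by rewrite raddf0 scale0r.
rewrite (@sum_coef_widen _ _ (fun i (a : {poly R}) => (alpha a : R) *: f 'X^i)
  _ (size t)) ?size_scale_leq//.
rewrite scaler_sumr; apply: eq_bigr => i _.
by rewrite coefZ mul_polyC linearZ/= scalerA.
Qed.

Lemma coprod_linear (a : R) (p q : {poly R}) :
  coprod (a *: p + q) = a%:P *: coprod p + coprod q.
Proof.
rewrite /coprod.
pose F n : {poly {poly R}} :=
  \sum_(k < n.+1) tens 'X^(n - k) 'X^k *+ 'C(n, k).
pose N := maxn (size p) (size q).
have g0 n : (0 : R)%:P *: F n = 0 by rewrite polyC0 scale0r.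
rewrite !(@sum_coef_widen _ _ (fun n (c : R) => c%:P *: F n) _ N)
  ?leq_maxl ?leq_maxr//; last first.
  by rewrite (leq_trans (size_polyD _ _))// geq_max !leq_max size_scale_leq leqnn orbT.
rewrite scaler_sumr -big_split/=; apply: eq_bigr => i _.
by rewrite coefD coefZ polyCD polyCM scalerDl scalerA.
Qed.

Lemma star_linear (V : lmodType R) (alpha : lindual R)
  (f : {linear {poly R} -> V}) : linear (star alpha f).
Proof.
by move=> a p q; rewrite /star coprod_linear tens_mapD tens_mapZ.
Qed.

End Linearity.

HB.instance Definition _ (R : realType) (V : lmodType R) (alpha : lindual R)
    (f : {linear {poly R} -> V}) :=
  GRing.isLinear.Build R {poly R} V *:%R (star alpha f)
    (@star_linear R V alpha f).

Definition counit (R : realType) (p : {poly R}) : R^o := p`_0.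

Lemma counit_linear (R : realType) : linear (@counit R).
Proof. by move=> a p q; rewrite /counit coefD coefZ. Qed.

HB.instance Definition _ (R : realType) :=
  GRing.isLinear.Build R {poly R} R^o *:%R (@counit R) (@counit_linear R).

Definition is_star_inv (R : realType) (alpha beta : lindual R) : Prop :=
  star alpha beta =1 @counit R /\ star beta alpha =1 @counit R.

(* Junk value alpha when alpha is not invertible; star_invP below shows that
   this does not happen on functionals with alpha 1 = 1. *)
Definition star_inv (R : realType) (alpha : lindual R) : lindual R :=
  match pselect (exists beta, is_star_inv alpha beta) with
  | left ex => projT1 (cid ex)
  | right _ => alpha
  end.

Section Theory.
Variable R : realType.

Lemma tens_map_tens (V : lmodType R) (alpha : lindual R)
    (f : {linear {poly R} -> V}) (u v : {poly R}) :
  tens_map alpha f (tens u v) = (alpha u : R) *: f v.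
Proof.
rewrite /tens_map /tens.
have g0 i : (alpha 0 : R) *: f 'X^i = 0 by rewrite raddf0 scale0r.
rewrite (@sum_coef_widen _ _ (fun i (a : {poly R}) => (alpha a : R) *: f 'X^i)
  _ (size v)) //; last first.
  by rewrite (leq_trans (size_scale_leq _ _))// size_poly.
rewrite -[in RHS](coefK v) poly_def raddf_sum scaler_sumr.
apply: eq_bigr => i _.
rewrite coefZ coef_map/= mulrC mul_polyC !linearZ/= scalerA.
by rewrite [in LHS]/GRing.scale/= mulrC.
Qed.

Lemma coprodXn n : coprod ('X^n : {poly R}) =
  \sum_(k < n.+1) tens 'X^(n - k) 'X^k *+ 'C(n, k).
Proof.
rewrite /coprod size_polyXn big_ord_recr/= big1 ?add0r => [|i _].
  by rewrite coefXn eqxx scale1r.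
by rewrite coefXn ltn_eqF// scale0r.
Qed.

Lemma starXn (V : lmodType R) (alpha : lindual R) (f : {linear {poly R} -> V}) n :
  star alpha f 'X^n =
  \sum_(k < n.+1) 'C(n, k)%:R *: ((alpha 'X^(n - k) : R) *: f 'X^k).
Proof.
rewrite /star coprodXn.
have t0 : tens_map alpha f 0 = 0 by rewrite /tens_map size_poly0 big_ord0.
rewrite (big_morph _ (@tens_mapD _ _ _ _) t0); apply: eq_bigr => k _.
rewrite -scaler_nat -polyC_natr tens_mapZ.
by rewrite tens_map_tens.
Qed.

Lemma eq_linear_Xn (V : lmodType R) (f g : {linear {poly R} -> V}) :
  (forall n, f 'X^n = g 'X^n) -> f =1 g.
Proof.
move=> fg p; rewrite -(coefK p) poly_def !linear_sum.
by apply: eq_bigr => i _; rewrite !linearZ/= fg.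
Qed.

Lemma starC (alpha beta : lindual R) : star alpha beta =1 star beta alpha.
Proof.
apply: eq_linear_Xn => n /=; rewrite !starXn (reindex_inj rev_ord_inj)/=.
apply: eq_bigr => k _; have kn : (k <= n)%N by rewrite -ltnS.
by rewrite subSS bin_sub// subKn// /GRing.scale/= [X in _ * X]mulrC.
Qed.

(* [star_inv_seq alpha n] lists beta(x^0), ..., beta(x^n). *)
Fixpoint star_inv_seq (alpha : lindual R) (n : nat) : seq R :=
  if n is m.+1 then
    let s := star_inv_seq alpha m in
    rcons s (- \sum_(k < m.+1) 'C(m.+1, k)%:R * (alpha 'X^(m.+1 - k) * s`_k))
  else [:: 1].

Lemma size_star_inv_seq alpha n : size (star_inv_seq alpha n) = n.+1.
Proof. by elim: n => //= n IHn; rewrite size_rcons IHn. Qed.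

Lemma nth_star_inv_seq alpha m n k : (k <= m)%N -> (m <= n)%N ->
  (star_inv_seq alpha n)`_k = (star_inv_seq alpha m)`_k.
Proof.
move=> km; elim: n => [|n IHn]; first by rewrite leqn0 => /eqP ->.
rewrite leq_eqVlt => /predU1P[->//|mn].
by rewrite /= nth_rcons size_star_inv_seq ltnS (leq_trans km)// IHn.
Qed.

Definition star_inv_fun (alpha : lindual R) (p : {poly R}) : R^o :=
  \sum_(n < size p) p`_n * (star_inv_seq alpha n)`_n.

Lemma star_inv_fun_linear alpha : linear (star_inv_fun alpha).
Proof.
move=> a p q; rewrite /star_inv_fun.
pose N := maxn (size p) (size q).
have g0 n : 0 * (star_inv_seq alpha n)`_n = 0 by rewrite mul0r.
rewrite !(@sum_coef_widen _ _ (fun n (c : R) => c * (star_inv_seq alpha n)`_n)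
  _ N) ?leq_maxl ?leq_maxr//; last first.
  by rewrite (leq_trans (size_polyD _ _))// geq_max !leq_max size_scale_leq leqnn orbT.
rewrite scaler_sumr -big_split/=; apply: eq_bigr => i _.
by rewrite coefD coefZ mulrDl -mulrA.
Qed.

HB.instance Definition _ alpha :=
  GRing.isLinear.Build R {poly R} R^o *:%R (star_inv_fun alpha)
    (@star_inv_fun_linear alpha).

Lemma star_inv_funXn alpha n :
  star_inv_fun alpha 'X^n = (star_inv_seq alpha n)`_n.
Proof.
rewrite /star_inv_fun size_polyXn big_ord_recr/= big1 ?add0r => [|i _].
  by rewrite coefXn eqxx mul1r.
by rewrite coefXn ltn_eqF// mul0r.
Qed.

Lemma star_inv_exists (alpha : lindual R) : alpha 1 = 1 ->
  exists beta, is_star_inv alpha beta.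
Proof.
move=> a1; exists (star_inv_fun alpha).
suff h : star alpha (star_inv_fun alpha) =1 @counit R.
  by split=> // p; rewrite starC h.
apply: eq_linear_Xn => n /=; rewrite starXn /counit coefXn.
rewrite big_ord_recr/= binn subnn expr0 a1 !scale1r star_inv_funXn.
case: n => [|n]; first by rewrite big_ord0 add0r.
rewrite /= nth_rcons size_star_inv_seq ltnn eqxx.
apply/eqP; rewrite subr_eq add0r; apply/eqP; apply: eq_bigr => k _.
rewrite star_inv_funXn /GRing.scale/=; congr (_ * (_ * _)).
by rewrite -(@nth_star_inv_seq _ _ n)// -ltnS.
Qed.

Lemma star_invP (alpha : lindual R) : alpha 1 = 1 ->
  is_star_inv alpha (star_inv alpha).
Proof.
move=> a1; rewrite /star_inv; case: pselect => [ex|/(_ (star_inv_exists a1))//].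
by case: cid.
Qed.

Lemma star_inv_uniq (alpha beta : lindual R) : alpha 1 = 1 ->
  is_star_inv alpha beta -> beta =1 star_inv alpha.
Proof.
move=> a1 [ab _]; have [ac _] := star_invP a1.
apply: eq_linear_Xn => n; elim/ltn_ind: n => n IHn.
have := etrans (ab 'X^n) (esym (ac 'X^n)).
rewrite !starXn !big_ord_recr/= binn subnn expr0 a1 !scale1r.
under eq_bigr do rewrite IHn//.
by move/addrI.
Qed.

End Theory.

(* Main.v *)
(* With nu := star_inv mu, naturality of the convolution product gives
   mu \o W = star nu mu and counit \o W = nu. An operator commuting with d/dx is
   determined by its composition with one functional alpha such that
   alpha 1 = 1: in each degree the derivative fixes its value up to a constant,
   and alpha fixes the constant. Part 1 is this principle for alpha = mu, where
   mu \o W is the counit. For alpha = counit it yields star mu W = id without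
   associativity of the convolution, and part 2 follows because convolution by
   mu is triangular with unit diagonal, hence injective. *)
Require Import Defs.
From mathcomp Require Import all_boot all_order all_algebra.
From mathcomp Require Import all_classical all_reals all_analysis.

Import Order.TTheory GRing.Theory Num.Theory.
Local Open Scope ring_scope.

Lemma deriv_eq0_const (R : numDomainType) (p : {poly R}) :
  p^`() = 0 -> p = (p`_0)%:P.
Proof.
move=> p'0; apply/polyP => -[|i]; rewrite coefC//=.
have /eqP := congr1 (fun q : {poly R} => q`_i) p'0.
by rewrite coef_deriv coef0 mulrn_eq0 => /eqP.
Qed.

Lemma deriv_comm_uniq (R : realType) (alpha : lindual R)
    (L M : {linear {poly R} -> {poly R}}) : alpha 1 = 1 ->
  (forall p, (L p)^`() = L p^`()) -> (forall p, (M p)^`() = M p^`()) ->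
  (forall n, alpha (L 'X^n) = alpha (M 'X^n)) -> L =1 M.
Proof.
move=> a1 dL dM aLM; apply: eq_linear_Xn => n.
have eq_of_deriv k : (L 'X^k - M 'X^k)^`() = 0 -> L 'X^k = M 'X^k.
  move=> /deriv_eq0_const; set c := _`_0 => LMc.
  (* The two values differ by the constant [c], and [alpha] sends that constant to [c] itself. *)
  have : alpha (c *: 1) = 0 by rewrite alg_polyC -LMc raddfB/= aLM subrr.
  rewrite linearZ/= a1 /GRing.scale/= mulr1 => c0.
  by apply/eqP; rewrite -subr_eq0 LMc c0 polyC0.
elim: n => [|n IHn]; apply: eq_of_deriv; apply/eqP;
  rewrite derivB dL dM derivXn subr_eq0.
  by rewrite mulr0n !linear0.
by rewrite !raddfMn/= IHn.
Qed.

(** With a functional as [g], this turns statements about operators into identities between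
    functionals. *)
Lemma star_comp (R : realType) (V U : lmodType R) (alpha : lindual R)
    (f : {linear {poly R} -> V}) (g : {linear V -> U}) (p : {poly R}) :
  g (star alpha f p) = star alpha (g \o f) p.
Proof. by rewrite /star /tens_map linear_sum; under eq_bigr do rewrite linearZ. Qed.

Lemma eq_star (R : realType) (V : lmodType R) (alpha : lindual R)
    (f g : {linear {poly R} -> V}) : f =1 g -> star alpha f =1 star alpha g.
Proof. by move=> fg p; apply: eq_bigr => k _; rewrite fg. Qed.

(** Only the [k = 0] term survives, since [counit] vanishes on positive powers. *)
Lemma star_counit (R : realType) (alpha : lindual R) :
  star alpha (@counit R) =1 alpha.
Proof.
apply: eq_linear_Xn => n /=; rewrite starXn big_ord_recl/= big1 ?addr0 => [|k _].
  by rewrite subn0 bin0 scale1r /counit expr0 coefC /GRing.scale/= mulr1.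
by rewrite /counit coefXn /= /GRing.scale/= !mulr0.
Qed.

Lemma starXn_scale (R : realType) (V : lmodType R) (alpha : lindual R)
    (f : {linear {poly R} -> V}) (n : nat) :
  star alpha f 'X^n =
    \sum_(k < n.+1) ('C(n, k)%:R * (alpha 'X^(n - k) : R)) *: f 'X^k.
Proof. by rewrite starXn; apply: eq_bigr => k _; rewrite scalerA. Qed.

(** The coproduct intertwines d/dx with d/dx acting on the right factor. On monomials this is the
    identity (k+1) C(n+1, k+1) = (n+1) C(n, k). *)
Lemma star_deriv (R : realType) (alpha : lindual R)
    (f : {linear {poly R} -> {poly R}}) :
  (forall p, (f p)^`() = f p^`()) ->
  forall p, (star alpha f p)^`() = star alpha f p^`().
Proof.
move=> df.
suff dX n : (star alpha f 'X^n)^`() = star alpha f ('X^n)^`().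
  by apply: (@eq_linear_Xn _ _ (deriv \o star alpha f) (star alpha f \o deriv)).
(* This kills the [k = 0] term, so the remaining indices shift down by one. *)
have df1 : (f 1)^`() = 0 by rewrite df -polyC1 derivC linear0.
case: n => [|n].
  by rewrite derivXn mulr0n (linear0 (star alpha f)) starXn big_ord1 !derivZ expr0 df1 !scaler0.
rewrite derivXn -scaler_nat linearZ/= !starXn big_ord_recl !derivD !derivZ.
rewrite expr0 df1 !scaler0 add0r (linear_sum (@deriv R)) scaler_sumr.
apply: eq_bigr => k _ /=.
rewrite !derivZ df derivXn -(scaler_nat (bump 0 k)) (linearZZ f) subSS.
set a : R := alpha _; rewrite !scalerA.
congr (_ *: _); rewrite mulrAC mulrA -!natrM; congr (_%:R * _).
by rewrite mulnC -mul_bin_diag.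
Qed.

Lemma star_inj (R : realType) (V : lmodType R) (alpha : lindual R)
    (f g : {linear {poly R} -> V}) : alpha 1 = 1 ->
  (forall n, star alpha f 'X^n = star alpha g 'X^n) -> f =1 g.
Proof.
move=> a1 fg; apply: eq_linear_Xn => n; elim/ltn_ind: n => n IHn.
have := fg n; rewrite !starXn !big_ord_recr/= binn subnn expr0 a1 !scale1r.
(* The lower terms agree by induction and cancel, leaving the diagonal term with coefficient
   [alpha 1 = 1]. *)
by under eq_bigr do rewrite IHn//; move/addrI.
Qed.

Theorem theorem1p1 (R : realType) (d : measure_display) (T : measurableType d)
    (P : probability T R) (X : {RV P >-> R})
    (X_moments : forall n : nat,
      P.-integrable [set: T]%classic (fun t => (X t ^+ n)%:E))
    (mu : lindual R)
    (mu_moments : forall n : nat,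
      (mu 'X^n : R)%:E = ('E_P[fun t => (X t ^+ n)%R])%E) :
  let W : {linear {poly R} -> {poly R}} := star (star_inv mu) idfun in
  (forall n : nat,
     W 'X^n = \sum_(k < n.+1)
       ('C(n, k)%:R * (star_inv mu 'X^(n - k) : R)) *: 'X^k)
  /\
  (forall L : {linear {poly R} -> {poly R}},
     [/\ L 1 = 1,
         (forall p : {poly R}, (L p)^`() = L p^`()) &
         (forall n : nat, (1 <= n)%N -> mu (L 'X^n) = 0)]
     <-> L =1 W)
  /\
  (forall L : {linear {poly R} -> {poly R}},
     (forall n : nat,
        'X^n = tens_map mu L (coprod 'X^n) /\
        tens_map mu L (coprod 'X^n) =
          \sum_(k < n.+1) ('C(n, k)%:R * (mu 'X^(n - k) : R)) *: L 'X^k)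
     <-> L =1 W).
Proof.
move=> W; set nu := star_inv mu.
(* The moment of order zero is the total mass of [P]. *)
have mu1 : mu 1 = 1.
  by have := mu_moments 0; rewrite expr0 (expectation_cst P (1 : R)) => -[].
have [munu numu] := star_invP mu1.
have nu1 : nu 1 = 1.
  have := munu 1; rewrite -(expr0 'X) starXn big_ord1 /counit coefXn eqxx.
  by rewrite subnn expr0 mu1 !scale1r.
have WD p : (W p)^`() = W p^`() by apply: star_deriv.
have muW p : mu (W p) = counit p by rewrite /W/= star_comp -numu.
have counit1 : counit (1 : {poly R}) = 1 by rewrite /counit coefC.
have muW_id : star mu W =1 (idfun : {poly R} -> {poly R}).
  apply: (@deriv_comm_uniq R (@counit R)) => // [p|n]; first exact: star_deriv.
  (* It remains to see that [counit \o W] is [nu], as [star mu nu] is the counit. *)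
  rewrite /= star_comp -munu; apply: (eq_star _ _ _ (_ \o _)) => p /=.
  by rewrite star_comp; apply: star_counit.
split=> [n|]; first exact: starXn_scale.
split=> L.
  split=> [[L1 LD muL]|LW].
    apply: (@deriv_comm_uniq R mu) => // n; rewrite muW /counit coefXn.
    by case: n => [|n]; [rewrite expr0 L1 mu1|rewrite muL].
  split=> [|p|n n_gt0].
  - rewrite LW /W/= -(expr0 'X) starXn big_ord1 subnn expr0 nu1 !scale1r//.
  - by rewrite !LW WD.
  - by rewrite LW muW /counit coefXn eq_sym eqn0Ngt n_gt0.
have starE (M : {linear {poly R} -> {poly R}}) n :
    tens_map mu M (coprod 'X^n) = star mu M 'X^n by [].
split=> [h|LW n].
  (* Convolution by [mu] sends both [L] and [W] to the identity. *)
  by apply: star_inj mu1 _ => n; rewrite muW_id -starE -(h n).1.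
split; last exact: starXn_scale.
by rewrite starE (eq_star _ _ _ _ _ LW) muW_id.
Qed.
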